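(* Let $q\ge 3$ and $p\ge 2q-1$ be integers, and let $H$ be any connected graph of order $q$. Then $$\mathrm{ex}\bigl(n,K_{\lceil p/(q-1)\rceil}\bigr)+\left\lceil\frac{p}{q-1}\right\rceil-1\le g(n,K_p|\langle K_q\rangle)\le g(n,K_p|\langle H\rangle)\le (1+o(1))\,\mathrm{ex}\bigl(n,K_{\lceil p/(q-1)\rceil}\bigr),$$ where $o(1)\to0$ as $n\to\infty$. In particular, the same asymptotic formula $(1+o(1))\,\mathrm{ex}(n,K_{\lceil p/(q-1)\rceil})$ applies for paths and cycles, determining $g(n,K_p|\langle P_q\rangle)$ and $g(n,K_p|\langle C_q\rangle)$.
   Context: $P_q$ and $C_q$ are the path and the cycle on $q$ vertices. For a graph $F$, $\langle F\rangle$ is the family of all graphs containing $F$ as a subgraph (not necessarily induced). $\mathrm{ex}(n,F)$ is the Turán number: the maximum number of edges in a graph of order $n$ containing no subgraph isomorphic to $F$. In an edge coloring of $K_n$ (not necessarily proper), for a copy $G'\subseteq K_n$ of a graph $G$, a color class of $G'$ is the graph formed by all edges of $G'$ having a given color that occurs in $G'$. For a family $\mathcal{F}$ of graphs with $K_2\notin\mathcal{F}$ and $n\ge|G|$, $g(n,G|\mathcal{F})$ is the largest integer $m$ for which there exists an edge coloring of $K_n$ using exactly $m$ colors such that every copy of $G$ contains a color class which is a member of $\mathcal{F}$; if no such coloring exists, then $g(n,G|\mathcal{F}):=0$. *)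

(* Defs.v *)
From HB Require Import structures.
From mathcomp Require Import all_boot all_order all_algebra.
From mathcomp Require Import boolp.

Set Implicit Arguments.
Unset Strict Implicit.
Unset Printing Implicit Defensive.

Import Order.TTheory GRing.Theory Num.Theory.

(* A finite simple graph is a vertex set inside an ambient finite type T,
   together with a set of edges, an edge being a two-element set of vertices.
   Keeping the ambient type lets subgraphs of a graph (copies of G in K_n and
   their color classes) live on the same type, with their own vertex sets. *)
Record graph (T : finType) := Graph {
  verts : {set T};
  edges : {set {set T}};
  edgesP : [forall e in edges, (#|e| == 2) && (e \subset verts)]
}.

Definition adj (T : finType) (G : graph T) : rel T :=
  fun x y => [set x; y] \in edges G.

Definition connected_graph (T : finType) (G : graph T) : Prop :=
  verts G != set0 /\ {in verts G &, forall x y, connect (adj G) x y}.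

Definition subgraph (T : finType) (S G : graph T) : Prop :=
  verts S \subset verts G /\ edges S \subset edges G.

Definition isomorphic (T U : finType) (G : graph T) (G' : graph U) : Prop :=
  exists f : T -> U,
    [/\ {in verts G &, injective f},
        [set f x | x in verts G] = verts G' &
        [set [set f x | x in (e : {set T})] | e in edges G] = edges G'].

Definition is_copy (T U : finType) (G : graph T) (K : graph U) (S : graph U) :
  Prop := subgraph S K /\ isomorphic G S.

Definition contains (T U : finType) (K : graph U) (F : graph T) : Prop :=
  exists S : graph U, is_copy F K S.

Lemma graph_of_rel_subproof (T : finType) (r : rel T) :
  [forall e in [set [set u.1; u.2] | u : T * T & (u.1 != u.2) && r u.1 u.2],
     (#|e| == 2) && (e \subset [set: T])].
Proof.
apply/forall_inP => e /imsetP[u]; rewrite inE => /andP[uu _] ->.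
by rewrite cards2 uu subsetT.
Qed.

(* Vertex set T; distinct x and y are joined when r x y or r y x. *)
Definition graph_of_rel (T : finType) (r : rel T) : graph T :=
  Graph (graph_of_rel_subproof r).

Definition complete_graph (n : nat) : graph 'I_n :=
  graph_of_rel (fun _ _ => true).

Definition path_graph (n : nat) : graph 'I_n :=
  graph_of_rel (fun i j : 'I_n => i.+1 == j :> nat).

(* This is a cycle only for 3 <= n. *)
Definition cycle_graph (n : nat) : graph 'I_n :=
  graph_of_rel (fun i j : 'I_n => i.+1 %% n == j :> nat).

(* The candidates m are bounded by the number of edges of K_n, which loses
   nothing; the same holds in g below. *)
Definition ex (n : nat) (T : finType) (F : graph T) : nat :=
  \max_(m < #|edges (complete_graph n)|.+1 |
    `[< exists G : graph 'I_n,
          [/\ #|verts G| = n, #|edges G| = m & ~ contains G F] >]) m.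

Definition graph_family := forall T : finType, graph T -> Prop.

Definition graphs_containing (T : finType) (F : graph T) : graph_family :=
  fun U G => contains G F.

Lemma color_class_subproof (T : finType) (C : eqType) (c : {set T} -> C)
    (G : graph T) (a : C) :
  [forall e in [set e in edges G | c e == a],
     (#|e| == 2) && (e \subset cover [set e in edges G | c e == a])].
Proof.
apply/forall_inP => e eA; rewrite bigcup_sup // andbT.
move: eA; rewrite inE => /andP[eG _].
by have /forall_inP/(_ e eG)/andP[] := edgesP G.
Qed.

Definition color_class (T : finType) (C : eqType) (c : {set T} -> C)
    (G : graph T) (a : C) : graph T :=
  Graph (color_class_subproof c G a).

(* An edge coloring of K_n with exactly m colors is a map on the edges of K_n
   that is onto 'I_m; its values on other subsets of 'I_n are never used. *)
Definition good_coloring (n m : nat) (T : finType) (G : graph T)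
    (F : graph_family) (c : {set 'I_n} -> 'I_m) : Prop :=
  [set c e | e in edges (complete_graph n)] = [set: 'I_m] /\
  forall G' : graph 'I_n, is_copy G (complete_graph n) G' ->
    exists2 a : 'I_m, a \in [set c e | e in edges G'] &
                      F _ (color_class c G' a).

(* The largest m for which there is a good coloring, and 0 if there is none,
   the maximum over an empty range being 0. *)
Definition g (n : nat) (T : finType) (G : graph T) (F : graph_family) : nat :=
  \max_(m < #|edges (complete_graph n)|.+1 |
    `[< exists c : {set 'I_n} -> 'I_m, good_coloring G F c >]) m.

Definition ceil_div (m d : nat) : nat := m %/ d + ~~ (d %| m).

Lemma ceil_divE (m d : nat) : 0 < d ->
  Num.ceil (m%:R / d%:R : rat)%R = (ceil_div m d)%:Z%R.
Proof.
move=> d0; apply: Num.Theory.ceil_def; rewrite /ceil_div /dvdn.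
have d0' : (0 < d%:R :> rat)%R by rewrite ltr0n.
rewrite ltr_pdivlMr // ler_pdivrMr // intrB -pmulrn mulrBl mul1r ltrBlDr.
rewrite -!natrM -natrD ltr_nat ler_nat.
have := divn_eq m d; set r := m %% d => mE; rewrite {2 3}mE mulnDl.
rewrite -addnA ltn_add2l leq_add2l.
case: eqP => [->|/eqP]; first by rewrite mul0n add0n d0.
by rewrite -lt0n => r0; rewrite mul1n -{1}[d]add0n ltn_add2r r0 ltnW ?ltn_pmod.
Qed.

(* Main.v *)
Require Import Defs.
From HB Require Import structures.
From mathcomp Require Import all_boot all_order all_algebra.
From mathcomp Require Import boolp zify lra.

Set Implicit Arguments.
Unset Strict Implicit.
Unset Printing Implicit Defensive.

Import Order.TTheory GRing.Theory Num.Theory.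

(** Put [r := k - 1], so that [r * (q - 1) < p <= r.+1 * (q - 1)] and [r >= 2].

    Lower bound ([leq_ex_g]). By Turan's theorem the extremal graph for [K_k] can
    be taken complete [r]-partite with balanced classes. Color its edges with
    distinct colors, and the inside of each class with one more color. Of any
    [p > r * (q - 1)] vertices some [q] lie in one class, which gives a
    monochromatic [K_q]; and a color class containing [K_q] contains [H].

    Upper bound ([coloring_upper]). Suppose that the number of colors exceeds
    [(1 - 1 / r + c) * n ^ 2 / 2] for a fixed [c > 0], choose one edge of each
    color, and call these edges selected. As in the Erdos-Stone theorem, they
    form a graph with a positive proportion of all copies of [K_k]
    ([supersaturation]), hence a positive proportion of all complete
    [k]-partite configurations with [q - 1] vertices in each part
    ([blowup_density]). A color belongs to only one selected edge, so
    configurations where a pair inside a part has the color of an edge between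
    two parts obey an equation determining one vertex from the others. They form
    a proportion [O(1 / n)] of all, so some configuration avoids them
    ([clean_blowup]). It has [k * (q - 1) >= p] vertices. A monochromatic
    connected subgraph with [q >= 3] vertices does not fit into a part, so it
    uses an edge between two parts and at least one more edge, necessarily of
    another color. Hence no [K_p] inside the configuration has a color class
    containing [H].

    Counting configurations as maps, injective or not, replaces the passage to a
    large complete multipartite subgraph: only proportions have to be compared.
    Both bounds are [(1 - 1 / r) * n ^ 2 / 2] up to lower order, since a balanced
    complete [r]-partite graph has that many edges ([ex_density]). Paths and
    cycles are connected graphs of order [q]. *)


(** * Embeddings, copies and connectedness *)

(** Containment is used throughout in the form of an embedding [f], which makes
    no reference to an intermediate subgraph. *)
Lemma containsP (T U : finType) (K : graph U) (F : graph T) :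
  contains K F <->
  exists f : T -> U,
    [/\ {in verts F &, injective f},
        {in verts F, forall x, f x \in verts K} &
        {in edges F, forall e : {set T}, f @: e \in edges K}].
Proof.
split=> [[S [[sV sE] [f [fI fV fE]]]]|[f [fI fV fE]]].
  exists f; split=> // [x xF|e eF].
    by apply: (subsetP sV); rewrite -fV; apply: imset_f.
  by apply: (subsetP sE); rewrite -fE; apply: imset_f.
have SP : [forall e in [set f @: (e : {set T}) | e in edges F],
             (#|e| == 2) && (e \subset f @: verts F)].
  apply/forall_inP => _ /imsetP[e eF ->].
  have /forall_inP/(_ e eF)/andP[/eqP e2 eV] := edgesP F.
  rewrite imsetS // andbT card_in_imset ?e2 //.
  by apply: sub_in2 fI => x /(subsetP eV).
exists (Graph SP); split; last by exists f.
split; first by apply/subsetP => _ /imsetP[x xF ->]; apply: fV.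
by apply/subsetP => _ /imsetP[e eF ->]; apply: fE.
Qed.

Lemma card_edge (T : finType) (G : graph T) :
  {in edges G, forall e : {set T}, #|e| = 2}.
Proof. by move=> e eG; have /forall_inP/(_ e eG)/andP[/eqP] := edgesP G. Qed.

Lemma edge_pair (T : finType) (G : graph T) (e : {set T}) :
  e \in edges G ->
  exists x y, [/\ x != y, e = [set x; y], x \in verts G & y \in verts G].
Proof.
move=> eG.
have /forall_inP/(_ e eG)/andP[/cards2P[x [y [xy ->]]] eV] := edgesP G.
by exists x, y; split => //; apply: (subsetP eV); rewrite !inE eqxx ?orbT.
Qed.

Lemma adjC (T : finType) (G : graph T) x y : adj G x y = adj G y x.
Proof. by rewrite /adj setUC. Qed.

Lemma adj_neq (T : finType) (G : graph T) x y : adj G x y -> x != y.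
Proof. by move=> /card_edge; rewrite cards2; case: (x == y). Qed.

Lemma adj_verts (T : finType) (G : graph T) x y :
  adj G x y -> x \in verts G /\ y \in verts G.
Proof.
move=> xy; have /forall_inP/(_ _ xy)/andP[_] := edgesP G.
by rewrite subUset !sub1set => /andP.
Qed.

Lemma adj_graph_of_rel (T : finType) (r : rel T) x y :
  adj (graph_of_rel r) x y = (x != y) && (r x y || r y x).
Proof.
apply/imsetP/andP => [[u]|[xy]].
  rewrite inE => /andP[uu ru] E.
  have xE : x \in [set u.1; u.2] by rewrite -E set21.
  have yE : y \in [set u.1; u.2] by rewrite -E set22.
  have xy : x != y.
    by move: (congr1 (fun A : {set T} => #|A|) E); rewrite !cards2 uu; case: eqP.
  split=> //; move: xE yE xy; rewrite !inE.
  by case/orP=> /eqP-> /orP[] /eqP->; rewrite ?eqxx // ru ?orbT.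
case/orP => rxy; [exists (x, y)|exists (y, x)]; rewrite ?inE //=.
- by rewrite xy.
- by rewrite eq_sym xy.
- by rewrite setUC.
Qed.

Lemma edges_complete n (e : {set 'I_n}) :
  (e \in edges (complete_graph n)) = (#|e| == 2).
Proof.
apply/idP/idP => [/edge_pair[x [y [xy -> _ _]]]|/cards2P[x [y [xy ->]]]].
  by rewrite cards2 xy.
by rewrite -/(adj _ x y) adj_graph_of_rel xy.
Qed.

Lemma imset_preimset (T U : finType) (f : T -> U) (A : {set U}) :
  A \subset f @: [set: T] -> f @: (f @^-1: A) = A.
Proof.
move=> sA; apply/setP => y; apply/imsetP/idP => [[x]|yA].
  by rewrite inE => ? ->.
by have /imsetP[x _ yE] := subsetP sA y yA; exists x; rewrite // inE -yE.
Qed.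

(** The copies of [K_p] in [K_n] are the complete graphs on the [p]-sets of
    vertices, so they can be handled without choosing isomorphisms. *)
Lemma is_copy_completeP n p (G : graph 'I_n) :
  is_copy (complete_graph p) (complete_graph n) G <->
  #|verts G| = p /\
  edges G = [set e : {set 'I_n} | (#|e| == 2) && (e \subset verts G)].
Proof.
split=> [[_ [f [fI fV fE]]]|[cG EG]].
  have {}fI : injective f by move=> x y; apply: fI; rewrite inE.
  split; first by rewrite -fV card_imset // cardsT card_ord.
  apply/setP => e; rewrite inE; apply/idP/idP => [eG|/andP[/eqP e2 eV]].
    by have /forall_inP/(_ e eG) := edgesP G.
  have fK : f @: (f @^-1: e) = e by apply: imset_preimset; rewrite fV.
  rewrite -fE -fK imset_f // edges_complete -e2.
  by rewrite -[in X in _ == X]fK card_imset.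
split.
  split; first by rewrite subsetT.
  by apply/subsetP => e; rewrite EG inE edges_complete => /andP[].
pose f i := enum_val (cast_ord (esym cG) i).
have fI : injective f by move=> i j /enum_val_inj/cast_ord_inj.
have fV : f @: [set: 'I_p] = verts G.
  apply/eqP; rewrite eqEcard card_imset // cardsT card_ord cG leqnn andbT.
  by apply/subsetP => _ /imsetP[i _ ->]; apply: enum_valP.
exists f; split => //; first by move=> x y _ _; apply: fI.
apply/setP => e; rewrite EG inE; apply/imsetP/andP => [[e0 e0E ->]|[e2 eV]].
  move: e0E; rewrite edges_complete card_imset // => ->; split => //.
  by rewrite -fV imsetS ?subsetT.
have fK : f @: (f @^-1: e) = e by apply: imset_preimset; rewrite fV.
by exists (f @^-1: e); rewrite // edges_complete -(card_imset _ fI) fK.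
Qed.

(** If no edge left [A], then [A] would be closed under adjacency, hence under
    the connectedness relation. *)
Lemma connected_leave (T : finType) (H : graph T) (A : {set T}) x y :
  connected_graph H -> x \in verts H -> y \in verts H ->
  x \in A -> y \notin A ->
  exists u v, [/\ u \in A, v \notin A & adj H u v].
Proof.
move=> [_ cH] xH yH xA yA; apply: contrapT => noE.
have clA : closed (adj H) A.
  move=> u v uv; apply/idP/idP => [uA|vA]; apply: contrapT.
    by move/negP => vA; apply: noE; exists u, v.
  by move/negP => uA; apply: noE; exists v, u; split; rewrite // adjC.
by have := closed_connect clA (cH x y xH yH); rewrite /= xA (negbTE yA).
Qed.

Lemma path_graph_connected q : connected_graph (path_graph q.+1).
Proof.
split; first by apply/set0Pn; exists ord0; apply: in_setT.
have adjS : connect_sym (adj (path_graph q.+1)).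
  by apply: sym_connect_sym => x y; rewrite adjC.
suff c0 x : connect (adj (path_graph q.+1)) ord0 x.
  by move=> x y _ _; apply: connect_trans (c0 y); rewrite adjS.
case: x => x; elim: x => [|x IH] xq.
  by rewrite (_ : Ordinal xq = ord0) ?connect0 //; apply: val_inj.
apply: connect_trans (IH (ltnW xq)) (connect1 _).
rewrite adj_graph_of_rel /= eqxx andbT.
by apply/eqP => /(congr1 val) /=; lia.
Qed.

(** The cycle contains the path on the same vertices. *)
Lemma cycle_graph_connected q : connected_graph (cycle_graph q.+1).
Proof.
have [V0 cP] := path_graph_connected q; split=> // x y xV yV.
apply: connect_sub (cP x y xV yV) => u v uv; apply: connect1; move: uv.
rewrite !adj_graph_of_rel => /andP[-> /=].
by case/orP => /eqP uv; apply/orP; [left|right]; rewrite uv modn_small.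
Qed.

Lemma contains_complete (T U : finType) (K : graph U) (H : graph T) :
  verts H != set0 -> contains K (complete_graph #|verts H|) -> contains K H.
Proof.
case/set0Pn=> x0 x0H /containsP[f [fI fV fE]]; apply/containsP.
have {}fI : injective f by move=> x y; apply: fI; apply: in_setT.
exists (f \o enum_rank_in x0H); split=> [x y xH yH|x xH|e eH].
- by move/fI; apply: enum_rank_in_inj.
- by apply: fV; apply: in_setT.
- rewrite imset_comp; apply: fE.
  have [x [y [xy -> xH yH]]] := edge_pair eH.
  rewrite imsetU1 imset_set1 edges_complete cards2.
  case: (enum_rank_in _ x =P _) xy => [/enum_rank_in_inj -> //|//].
  by rewrite eqxx.
Qed.

Lemma contains_subgraph (T U : finType) (K K' : graph U) (F : graph T) :
  subgraph K K' -> contains K F -> contains K' F.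
Proof.
move=> [sV sE] /containsP[f [fI fV fE]]; apply/containsP; exists f.
by split=> // [x /fV|e /fE]; apply: subsetP.
Qed.

(** Handshake. The ordered pairs of ends are fibred over the edges, with two
    pairs above each edge. It is stated for a set of edges, so that it also
    applies to the edges selected from a coloring. *)
Lemma sum_degree (T : finType) (E : {set {set T}}) :
  {in E, forall e : {set T}, #|e| = 2} ->
  \sum_x #|[set y | [set x; y] \in E]| = 2 * #|E|.
Proof.
move=> E2.
under eq_bigr do rewrite -sum1dep_card.
rewrite pair_big_dep /= (partition_big (fun u : T * T => [set u.1; u.2]) (mem E)) //=.
rewrite mulnC -sum_nat_const; apply: eq_bigr => e eE.
have /eqP/cards2P[x [y [xy eE2]]] := E2 e eE.
have -> : 2 = #|[set (x, y); (y, x)]| by rewrite cards2 xpair_eqE (negbTE xy).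
rewrite sum1dep_card; apply: eq_card => -[u v]; rewrite !inE /= !xpair_eqE.
apply/andP/orP => [[_ /eqP uv]|[] /andP[/eqP-> /eqP->]]; last 2 first.
- by rewrite -eE2.
- by rewrite setUC -eE2.
have uv2 : u != v.
  by have := E2 e eE; rewrite -uv cards2; case: eqP.
have : u \in e by rewrite -uv set21.
have : v \in e by rewrite -uv set22.
rewrite eE2 !inE.
by case/orP=> /eqP vE /orP[] /eqP uE; move: uv2; rewrite uE vE ?eqxx //; [right|left].
Qed.

(** * Turan's theorem by degree majorization *)

(** [K_(r.+1)]-freeness of the graph that [e] induces on [A]. *)
Definition cliques_le (T : finType) (e : rel T) (A : {set T}) (r : nat) : Prop :=
  forall B : {set T}, B \subset A ->
    {in B &, forall x y, x != y -> e x y} -> #|B| <= r.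

(** Erdos's form of Turan's theorem: a graph on [A] without cliques of more than
    [r] vertices is dominated, degree by degree, by a complete [r]-partite
    graph. By induction on [r]: the neighborhood [N] of a vertex [v] of maximum
    degree has smaller cliques, so it is dominated by an [(r-1)]-partite graph,
    and all the vertices of [A] outside [N] form one new class. A vertex outside
    [N] is then joined to the whole of [N], so it has degree [deg v]; a vertex
    of [N] gains every neighbor that it can have outside [N]. *)
Lemma degree_majorization (T : finType) (e : rel T) (A : {set T}) (r : nat) :
  symmetric e -> irreflexive e -> cliques_le e A r ->
  exists2 h : T -> nat,
    {in A, forall x, h x < r} &
    {in A, forall x,
       #|[set y in A | e x y]| <= #|[set y in A | h x != h y]|}.
Proof.
move=> eC e0; elim: r A => [|r IH] A rA.
  suff A0 : A = set0 by exists (fun=> 0) => x; rewrite A0 inE.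
  apply/setP => x; rewrite inE; apply/negP => xA.
  suff : #|[set x]| <= 0 by rewrite cards1.
  apply: rA; first by rewrite sub1set.
  by move=> y z; rewrite !inE => /eqP-> /eqP->; rewrite eqxx.
have [->|[v0 v0A]] := set_0Vmem A; first by exists (fun=> 0) => x; rewrite inE.
pose deg x := #|[set y in A | e x y]|.
have [v vA0 vmax] := arg_maxnP deg v0A.
have vA : v \in A := vA0.
pose N := [set y in A | e v y].
have NA : N \subset A by apply/subsetP => y; rewrite inE => /andP[].
have rN : cliques_le e N r.
  move=> B BN Be.
  have vB : v \notin B.
    by apply/negP => /(subsetP BN); rewrite inE e0 andbF.
  have BeE y : y \in B -> e v y by move/(subsetP BN); rewrite inE => /andP[].
  have := rA (v |: B); rewrite cardsU1 vB add1n ltnS; apply.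
    by rewrite subUset sub1set vA (subset_trans BN).
  move=> x y; rewrite !inE => /orP[/eqP->|xB] /orP[/eqP->|yB]; rewrite ?eqxx //.
  - by move=> _; apply: BeE.
  - by move=> _; rewrite eC; apply: BeE.
  - exact: Be.
have [h hr hN] := IH N rN.
pose h' x := if x \in N then h x else r.
exists h' => x xA; rewrite /h'.
  by case: ifP => // xN; rewrite ltnW // ltnS hr.
have splitA (P : pred T) :
  #|[set y in A | P y]| = #|[set y in N | P y]| + #|[set y in A :\: N | P y]|.
  rewrite -(cardsID N [set y in A | P y]); congr (_ + _); apply: eq_card => y;
    by rewrite !inE; case: (y \in A); case: (e v y); case: (P y).
case: ifP => xN.
  rewrite !splitA; apply: leq_add.
    apply: leq_trans (hN x xN) _; apply: subset_leq_card; apply/subsetP => y.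
    by rewrite !inE => /andP[/andP[-> ->]].
  apply: leq_trans (_ : #|A :\: N| <= _); apply: subset_leq_card; apply/subsetP.
    by move=> y; rewrite !inE => /andP[].
  move=> y /setDP[yA yN]; rewrite inE (negbTE yN) inE yA yN /=.
  by rewrite neq_ltn hr.
apply: leq_trans (vmax x xA) _; rewrite /deg -/N; apply: subset_leq_card.
apply/subsetP => y yN; rewrite inE (subsetP NA) //= yN.
by rewrite neq_ltn hr // orbT.
Qed.

Definition class_size (T : finType) (r : nat) (h : T -> 'I_r) (a : 'I_r) : nat :=
  #|[set x | h x == a]|.

(** Twice the number of edges of the complete multipartite graph whose classes
    are those of [h]. *)
Definition cross_pairs (T : finType) (r : nat) (h : T -> 'I_r) : nat :=
  \sum_x #|[set y | h x != h y]|.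

(** Maximizing the number of edges of a complete multipartite graph thus amounts
    to minimizing the sum of the squares of the class sizes. *)
Lemma cross_pairs_class (T : finType) (r : nat) (h : T -> 'I_r) :
  cross_pairs h + \sum_a class_size h a ^ 2 = #|T| ^ 2.
Proof.
have -> : \sum_a class_size h a ^ 2 = \sum_x class_size h (h x).
  rewrite (partition_big h predT) //=; apply: eq_bigr => a _.
  rewrite (eq_bigr (fun=> class_size h a)) => [|x /eqP-> //].
  by rewrite sum_nat_const -mulnn; congr (_ * _); rewrite /class_size cardsE.
rewrite -big_split /= (eq_bigr (fun=> #|T|)) => [|x _].
  by rewrite sum_nat_const mulnn.
rewrite addnC -(cardsC [set y | h y == h x]); congr (_ + _).
by apply: eq_card => y; rewrite !inE eq_sym.
Qed.

Lemma sum_class_size (T : finType) (r : nat) (h : T -> 'I_r) :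
  \sum_a class_size h a = #|T|.
Proof.
rewrite -sum1_card (partition_big h predT) //=; apply: eq_bigr => a _.
by rewrite sum1_card /class_size cardsE.
Qed.

(** Moving one vertex from a class of size [m] to a class of size [l] changes the
    sum of squares by [2 * (l - m + 1)]. *)
Lemma move_vertex (T : finType) (r : nat) (h : T -> 'I_r) (a b : 'I_r) :
  class_size h b + 1 < class_size h a ->
  exists h' : T -> 'I_r, \sum_c class_size h' c ^ 2 < \sum_c class_size h c ^ 2.
Proof.
move=> lt_ba.
have ab : a != b by apply: contraTneq lt_ba => ->; rewrite -leqNgt leq_addr.
have /card_gt0P[x] : 0 < #|[set x | h x == a]|.
  by apply: leq_ltn_trans lt_ba.
rewrite inE => /eqP hx.
pose h' y := if y == x then b else h y; exists h'.
have Ea : class_size h a = (class_size h' a).+1.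
  rewrite /class_size (cardsD1 x) inE hx eqxx add1n; congr _.+1.
  apply: eq_card => y; rewrite !inE /h'; case: (y =P x) => //= _.
  by rewrite eq_sym (negbTE ab).
have Eb : class_size h' b = (class_size h b).+1.
  rewrite /class_size (cardsD1 x) inE /h' !eqxx add1n; congr _.+1.
  apply: eq_card => y; rewrite !inE; case: (y =P x) => //= ->.
  by rewrite hx (negbTE ab).
have Ec c : (c != b) && (c != a) -> class_size h' c = class_size h c.
  case/andP=> cb ca; apply: eq_card => y; rewrite !inE /h'; case: (y =P x) => // ->.
  by rewrite hx eq_sym (negbTE cb) eq_sym (negbTE ca).
rewrite (bigD1 b) // (bigD1 a) //= [X in _ < X](bigD1 b) // (bigD1 a) //=.
rewrite (eq_bigr (fun c => class_size h c ^ 2)) => [|c /Ec-> //].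
by rewrite !addnA ltn_add2r; nia.
Qed.

(** Among all [r]-colorings, one minimizing the sum of the squares of the class
    sizes is balanced by [move_vertex], and has at least as many crossing pairs
    as the coloring given by [degree_majorization]. *)
Lemma turan_coloring (T : finType) (e : rel T) (r : nat) :
  0 < r -> symmetric e -> irreflexive e -> cliques_le e [set: T] r ->
  exists h : T -> 'I_r,
    \sum_x #|[set y | e x y]| <= cross_pairs h /\
    forall a b, class_size h a <= (class_size h b).+1.
Proof.
case: r => // r _ eC e0 /(degree_majorization eC e0)[h0 h0r h0P].
pose S (f : {ffun T -> 'I_r.+1}) := \sum_c class_size f c ^ 2.
pose f0 := [ffun x => inord (h0 x) : 'I_r.+1].
have [f _ fmin] := arg_minnP S (isT : predT f0).
exists f; split; last first.
  move=> a b; rewrite leqNgt; apply/negP; rewrite -addn1 => /move_vertex[h' lt].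
  have := fmin (finfun h') isT; rewrite leqNgt => /negP; apply.
  apply: leq_trans lt; rewrite ltnS leq_eqVlt; apply/orP; left; apply/eqP.
  by apply: eq_bigr => c _; congr (_ ^ 2); apply: eq_card => y; rewrite !inE ffunE.
apply: leq_trans (_ : cross_pairs f0 <= _); last first.
  have := cross_pairs_class f; rewrite -(cross_pairs_class f0) -/(S f) -/(S f0).
  have : S f <= S f0 by apply: fmin.
  by move: (S f) (S f0) => a b; lia.
apply: leq_sum => x _; have := h0P x (in_setT x).
have sE (P : pred T) : [set y in [set: T] | P y] = [set y | P y].
  by apply/setP => y; rewrite !inE.
rewrite !sE => /leq_trans; apply; apply: subset_leq_card; apply/subsetP => y.
rewrite !inE !ffunE; apply: contraNneq => /(congr1 val).
by rewrite /= !inordK ?h0r ?in_setT // => ->.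
Qed.

(** In a balanced coloring, [r] times a class size is at most [#|T| + r]. *)
Lemma balanced_cross_pairs (T : finType) (r : nat) (h : T -> 'I_r) :
  (forall a b, class_size h a <= (class_size h b).+1) ->
  (r - 1) * #|T| ^ 2 <= r * cross_pairs h + r * #|T|.
Proof.
move=> bal.
have le a : r * class_size h a <= #|T| + r.
  have -> : r * class_size h a = \sum_(b < r) class_size h a.
    by rewrite sum_nat_const card_ord.
  have -> : #|T| + r = \sum_b (class_size h b + 1).
    by rewrite big_split /= sum_class_size sum1_card card_ord.
  by apply: leq_sum => b _; rewrite addn1.
have : r * \sum_a class_size h a ^ 2 <= #|T| * (#|T| + r).
  rewrite -{1}(sum_class_size h) big_distrr big_distrl /=; apply: leq_sum => a _.
  by rewrite -mulnn mulnCA leq_mul2l le orbT.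
by have := cross_pairs_class h; nia.
Qed.

(** The Cauchy-Schwarz inequality bounds the sum of the squares of the class sizes
    from below by [#|T| ^ 2 / r]. *)
Lemma turan_density (T : finType) (e : rel T) (r : nat) :
  0 < r -> symmetric e -> irreflexive e -> cliques_le e [set: T] r ->
  r * \sum_x #|[set y | e x y]| <= (r - 1) * #|T| ^ 2.
Proof.
move=> r0 eC e0 /(turan_coloring r0 eC e0)[h [hle _]].
have CS : #|T| ^ 2 <= r * \sum_a class_size h a ^ 2.
  rewrite -(leq_pmul2l (isT : 0 < 2)) -(sum_class_size h).
  have -> : 2 * (\sum_a class_size h a) ^ 2 =
    \sum_a \sum_b 2 * (class_size h a * class_size h b).
    rewrite -mulnn big_distrl big_distrr /=; apply: eq_bigr => a _.
    by rewrite big_distrr big_distrr.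
  have -> : 2 * (r * \sum_a class_size h a ^ 2) =
    \sum_a \sum_b (class_size h a ^ 2 + class_size h b ^ 2).
    under [RHS]eq_bigr do rewrite big_split /= sum_nat_const card_ord.
    by rewrite big_split /= sum_nat_const card_ord -big_distrr /=; lia.
  by apply: leq_sum => a _; apply: leq_sum => b _; apply: nat_Cauchy.
by have := cross_pairs_class h; nia.
Qed.

(** * Blow-ups and supersaturation *)

(** If the values of [f], all at most [N], are at least [N / d] on average, then
    at least a proportion [1 / (2 * d)] of them are at least [N / (2 * d)]. *)
Lemma popular (Y : finType) (f : Y -> nat) (N d : nat) :
  0 < N -> (forall y, f y <= N) -> N * #|Y| <= d * \sum_y f y ->
  #|Y| <= 2 * d * #|[set y | N <= 2 * d * f y]|.
Proof.
move=> N0 fN avg.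
have le : 2 * d * \sum_y f y <=
          2 * d * N * #|[set y | N <= 2 * d * f y]| + N * #|Y|.
  rewrite (bigID [pred y | N <= 2 * d * f y]) /= mulnDr; apply: leq_add.
    rewrite -[leqRHS]mulnA leq_mul2l; apply/orP; right.
    rewrite -sum1_card big_distrr /=.
    by under [leqRHS]eq_bigl do rewrite inE; apply: leq_sum => y _; rewrite muln1.
  rewrite big_distrr /= -sum1_card big_distrr /=.
  rewrite [leqRHS](bigID [pred y | N <= 2 * d * f y]) /=.
  apply: leq_trans (leq_addl _ _); apply: leq_sum => y; rewrite -ltnNge muln1.
  exact: ltnW.
rewrite -(leq_pmul2l N0); move: avg le; set S := \sum_y _; set G := #|[set _ | _]|.
by move: #|Y| => m; nia.
Qed.

Lemma card_tuple_cons (V : finType) (k : nat) (W : pred (seq V)) :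
  #|[set t : k.+1.-tuple V | W t]| =
  \sum_a #|[set t : k.-tuple V | W (a :: t)]|.
Proof.
rewrite -sum1dep_card (reindex (fun u : V * k.-tuple V => cons_tuple u.1 u.2)) /=.
  rewrite [RHS](eq_bigr (fun a => \sum_(t : k.-tuple V | W (a :: t)) 1)) => [|a _].
    by rewrite pair_big_dep.
  by rewrite sum1dep_card.
exists (fun t : k.+1.-tuple V => (thead t, behead_tuple t)) => [[a t]|t] _ /=.
  by congr pair; apply: val_inj.
by rewrite [RHS]tuple_eta.
Qed.

Lemma card_tuple_all (V : finType) (s : nat) (P : pred V) :
  #|[set A : s.-tuple V | all P A]| = #|[set a | P a]| ^ s.
Proof.
elim: s => [|s IH].
  have -> : [set A : 0.-tuple V | all P A] = setT.
    by apply/setP => A; rewrite !inE tuple0.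
  by rewrite cardsT card_tuple.
rewrite (@card_tuple_cons _ _ (all P)) expnS -IH -sum1dep_card big_distrl /=.
rewrite [RHS]big_mkcond; apply: eq_bigr => a _; rewrite mul1n; case: (P a) => //=.
by apply/eqP; rewrite cards_eq0; apply/eqP/setP => t; rewrite !inE.
Qed.

(** All the sequences obtained by choosing one element in each member of [l]
    satisfy [W]. The recursion imposes the choices in the first member on [W]
    rather than quantifying outside, which is the form that the induction in
    [blowup_density] produces. *)
Fixpoint transversals_in (V : finType) (W : pred (seq V)) (l : seq (seq V)) :=
  if l is A :: l' then
    transversals_in (fun t => all (fun a => W (a :: t)) A) l'
  else W [::].

Lemma transversals_in_nth (V : finType) (W : pred (seq V)) x0 l t :
  transversals_in W l -> size t = size l ->
  (forall i, i < size l -> nth x0 t i \in nth [::] l i) -> W t.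
Proof.
elim: l W t => [|A l IH] W [|a t] //= tr [tl] mem.
by have /allP := IH _ t tr tl (fun i => mem i.+1); apply; apply: (mem 0).
Qed.

(** Erdos's theorem on [k]-partite [k]-uniform hypergraphs, in counting form: a
    [k]-ary relation of density at least [1 / d] contains a positive proportion
    of all the complete [k]-partite configurations with [s] (not necessarily
    distinct) vertices in each part. By induction on [k]: a positive proportion
    of the [k]-tuples [t] extend by at least [n / (2 * d)] first elements, hence
    by at least [(n / (2 * d)) ^ s] [s]-tuples of first elements; by double
    counting, for a positive proportion of the [s]-tuples [A] the relation
    holding at [t] when all elements of [A] extend [t] is dense, and the
    induction hypothesis applies to it. Only the existence of [D] matters, and
    that it does not depend on [V] and [W]. *)
Lemma blowup_density k s d : exists D, forall (V : finType) (W : pred (seq V)),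
  0 < #|V| -> #|V| ^ k <= d * #|[set t : k.-tuple V | W t]| ->
  #|V| ^ (s * k) <=
    D * #|[set l : k.-tuple (s.-tuple V) | transversals_in W (map val l)]|.
Proof.
elim: k d => [|k IH] d.
  exists d => V W _; rewrite muln0.
  have -> : [set t : 0.-tuple V | W t] = if W [::] then setT else set0.
    by apply/setP => t; rewrite inE tuple0 /=; case: (W _); rewrite inE.
  have -> : [set l : 0.-tuple (s.-tuple V) | transversals_in W (map val l)] =
            if W [::] then setT else set0.
    by apply/setP => t; rewrite inE tuple0 /=; case: (W _); rewrite inE.
  by case: (W _); rewrite ?cards0 // !cardsT !card_tuple.
pose D1 := (2 * d) ^ s.+1; have [D2 HD2] := IH (2 * D1).
exists (2 * D1 * D2) => V W V0.
set n := #|V| in V0 *.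
pose f (t : k.-tuple V) := #|[set a | W (a :: t)]|.
pose WA (A : seq V) := fun t : seq V => all (fun a => W (a :: t)) A.
pose gA (A : s.-tuple V) := #|[set t : k.-tuple V | WA A t]|.
rewrite card_tuple_cons.
have -> : \sum_a #|[set t : k.-tuple V | W (a :: t)]| = \sum_t f t.
  under eq_bigr do rewrite -sum1dep_card big_mkcond /=.
  rewrite exchange_big /=; apply: eq_bigr => t _.
  by rewrite /f -sum1dep_card [RHS]big_mkcond.
have gAf : \sum_A gA A = \sum_t f t ^ s.
  rewrite /gA; under eq_bigr do rewrite -sum1dep_card big_mkcond /=.
  rewrite exchange_big /=; apply: eq_bigr => t _.
  by rewrite /f -card_tuple_all -sum1dep_card [RHS]big_mkcond.
move=> dense.
have fn t : f t <= n by apply: max_card.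
have Ck : #|{: k.-tuple V}| = n ^ k by rewrite card_tuple.
have Cs : #|{: s.-tuple V}| = n ^ s by rewrite card_tuple.
(* Many [t] have many extensions. *)
have pop1 : n ^ k <= 2 * d * #|[set t | n <= 2 * d * f t]|.
  by rewrite -Ck; apply: popular => //; rewrite Ck -expnS.
(* Count the pairs of [A] and [t] with all elements of [A] extending [t]. *)
have dense2 : n ^ k * #|{: s.-tuple V}| <= D1 * \sum_A gA A.
  rewrite gAf Cs /D1 expnS -mulnA.
  apply: leq_trans (leq_mul pop1 (leqnn (n ^ s))) _.
  rewrite -mulnA leq_mul2l; apply/orP; right.
  rewrite -sum1dep_card big_distrl big_distrr /= big_mkcond /=.
  apply: leq_sum => t _; case: ifP => // le; rewrite mul1n -expnMn.
  by case: (posnP s) => [->|s0]; rewrite // leq_exp2r.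
have pop2 : n ^ s <= 2 * D1 * #|[set A | n ^ k <= 2 * D1 * gA A]|.
  rewrite -Cs; apply: popular => //; first by rewrite expn_gt0 V0.
  by move=> A; rewrite -Ck; apply: max_card.
rewrite (@card_tuple_cons _ _ (fun l => transversals_in W (map val l))).
rewrite mulnS expnD -mulnA.
apply: leq_trans (leq_mul pop2 (leqnn (n ^ (s * k)))) _.
rewrite -mulnA leq_mul2l; apply/orP; right.
rewrite -sum1dep_card big_distrl big_distrr /= big_mkcond /=.
apply: leq_sum => A _; case: ifP => // le; rewrite mul1n.
exact: HD2.
Qed.

(** For a uniformly random [f], the pair [(f i, f j)] is uniformly distributed:
    swapping the values of [f] at [i] and [j] with an independent pair is an
    involution. *)
Lemma card_sample_pair (I V : finType) (R : rel V) (i j : I) : i != j ->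
  #|[set f : {ffun I -> V} | R (f i) (f j)]| * #|V| ^ 2 =
  #|V| ^ #|I| * \sum_x #|[set y | R x y]|.
Proof.
move=> ij.
pose sw (w : {ffun I -> V} * (V * V)) : {ffun I -> V} * (V * V) :=
  ([ffun z => if z == i then w.2.1 else if z == j then w.2.2 else w.1 z],
   (w.1 i, w.1 j)).
have swK : involutive sw.
  move=> [f [x y]]; rewrite /sw /= !ffunE !eqxx eq_sym (negbTE ij); congr pair.
  by apply/ffunP => z; rewrite !ffunE; do 2?case: eqP => [->|_] //.
have -> : \sum_x #|[set y | R x y]| = #|[set u : V * V | R u.1 u.2]|.
  rewrite -sum1dep_card -(pair_big_dep predT R (fun _ _ => 1)) /=.
  by apply: eq_bigr => x _; rewrite sum1dep_card.
rewrite -mulnn -card_prod -card_ffun -!cardsT -!cardsX.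
rewrite -(card_imset _ (inv_inj swK)); apply: eq_card => w.
rewrite -{1}(swK w) mem_imset ?inE /=; last exact: inv_inj.
by rewrite !ffunE !eqxx eq_sym (negbTE ij) andbT.
Qed.

Lemma leq_card_bigcup (J U : finType) (B : J -> {set U}) :
  #|\bigcup_j B j| <= \sum_j #|B j|.
Proof.
apply: (big_ind2 (fun (A : {set U}) m => #|A| <= m)); rewrite ?cards0 //.
move=> A1 m1 A2 m2 h1 h2; apply: leq_trans (leq_card_setU _ _).1 _.
exact: leq_add.
Qed.

(** A graph whose density exceeds Turan's bound [1 - 1 / r] by [1 / (d * r)] has
    a positive proportion of copies of [K_(r.+1)]. Pull the graph back along a
    random map [f] from [M] points. If the pulled back graph has no
    [K_(r.+1)], Turan's bound holds for it; as this bound is exceeded on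
    average, many maps [f] yield a [K_(r.+1)], and a positive proportion of
    them yield it at the same positions [iota]. The value of [M] is the least
    for which the loss from the diagonal pairs, a factor [(M - 1) / M], stays
    below the excess of density. *)
Lemma supersaturation (V : finType) (e : rel V) (r d : nat) :
  0 < r -> 0 < d -> 0 < #|V| -> symmetric e -> irreflexive e ->
  (d * (r - 1) + 1) * #|V| ^ 2 <= r * d * \sum_x #|[set y | e x y]| ->
  let M := d * (r - 1) + 2 in
  exists iota : {ffun 'I_r.+1 -> 'I_M},
  #|V| ^ M <= r * d * M * M ^ r.+1 *
    #|[set f : {ffun 'I_M -> V} |
        [forall i, forall j, (i != j) ==> e (f (iota i)) (f (iota j))]]|.
Proof.
move=> r0 d0 V0 eC e0 dense M.
set n := #|V| in V0 dense *; set E := \sum_x _ in dense.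
pose Wi (iota : {ffun 'I_r.+1 -> 'I_M}) : {set {ffun 'I_M -> V}} :=
  [set f : {ffun 'I_M -> V} |
    [forall i, forall j, (i != j) ==> e (f (iota i)) (f (iota j))]].
pose good := [set f | [exists iota, f \in Wi iota]].
pose O (f : {ffun 'I_M -> V}) := \sum_i #|[set j | e (f i) (f j)]|.
have Cf : #|{ffun 'I_M -> V}| = n ^ M by rewrite card_ffun card_ord.
have OM f : O f <= M ^ 2.
  have -> : M ^ 2 = \sum_(i < M) #|'I_M|.
    by rewrite sum_nat_const card_ord mulnn.
  by apply: leq_sum => i _; apply: max_card.
have Obad f : f \notin good -> r * O f <= (r - 1) * M ^ 2.
  move=> fB; have -> : M ^ 2 = #|'I_M| ^ 2 by rewrite card_ord.
  apply: (@turan_density _ (fun i j => e (f i) (f j))) => // B _ Be.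
  rewrite leqNgt; apply: contraNN fB => cB.
  rewrite inE; apply/existsP.
  exists [ffun i => enum_val (widen_ord cB i)]; rewrite inE.
  apply/forallP => i; apply/forallP => j; apply/implyP => ij; rewrite !ffunE.
  apply: Be; rewrite ?enum_valP //; apply: contra_neq ij.
  by move/enum_val_inj/(congr1 val) => /= /val_inj.
have sumO : (\sum_f O f) * n ^ 2 = M * (M - 1) * (n ^ M * E).
  have -> : M * (M - 1) * (n ^ M * E) =
    \sum_(i < M) \sum_(j < M | j != i) n ^ M * E.
    have cj (i : 'I_M) : \sum_(j < M | j != i) n ^ M * E = (M - 1) * (n ^ M * E).
      by rewrite sum_nat_const cardC1 card_ord subn1.
    by under eq_bigr do rewrite cj; rewrite sum_nat_const card_ord -mulnA.
  rewrite /O exchange_big big_distrl /=; apply: eq_bigr => i _.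
  under eq_bigr do rewrite -sum1dep_card big_mkcond /=.
  rewrite exchange_big big_distrl (bigD1 i) //= big1 ?add0n => [|f _].
    apply: eq_bigr => j ji; rewrite -big_mkcond sum1dep_card card_sample_pair.
      by rewrite card_ord.
    by rewrite eq_sym.
  by rewrite e0.
have sumle : r * \sum_f O f <= (r - 1) * M ^ 2 * n ^ M + r * M ^ 2 * #|good|.
  rewrite big_distrr /= -Cf -!sum1_card !big_distrr /=.
  rewrite [X in _ + X]big_mkcond -big_split /=; apply: leq_sum => f _.
  rewrite !muln1; case: ifPn => [_|/Obad/leq_trans]; last by apply; apply: leq_addr.
  by apply: leq_trans (leq_addl _ _); rewrite leq_mul2l OM orbT.
have goodle : n ^ M <= r * d * M * #|good|.
  have n20 : 0 < n ^ 2 by rewrite expn_gt0 V0.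
  have M0 : 0 < M by rewrite /M addn2.
  have step1 : M * (M - 1) * (d * (r - 1) + 1) * n ^ M * n ^ 2 <=
     d * ((r - 1) * M ^ 2 * n ^ M + r * M ^ 2 * #|good|) * n ^ 2.
    apply: leq_trans (_ : d * (r * \sum_f O f) * n ^ 2 <= _); last first.
      by rewrite leq_mul2r leq_mul2l sumle !orbT.
    have -> : d * (r * \sum_f O f) * n ^ 2 = M * (M - 1) * n ^ M * (r * d * E).
      by rewrite -mulnA -mulnA sumO; move: (M - 1) (n ^ M) => a b; lia.
    have -> : M * (M - 1) * (d * (r - 1) + 1) * n ^ M * n ^ 2 =
      M * (M - 1) * n ^ M * ((d * (r - 1) + 1) * n ^ 2).
      by move: (M - 1) (n ^ M) (n ^ 2) (d * (r - 1) + 1) => a b c1 c2; lia.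
    by rewrite leq_mul2l dense orbT.
  rewrite leq_pmul2r // in step1.
  have {}step1 : M * ((M - 1) * (d * (r - 1) + 1) * n ^ M) <=
     M * (d * (r - 1) * M * n ^ M + r * d * M * #|good|).
    rewrite !mulnA; apply: leq_trans step1 _; rewrite -mulnn.
    by move: (r - 1) (n ^ M) #|good| => a b c1; lia.
  rewrite leq_pmul2l // in step1.
  move: step1; have -> : M - 1 = d * (r - 1) + 1 by rewrite /M; lia.
  rewrite {2}/M; move: (d * (r - 1)) (n ^ M) (r * d * M * #|good|) => x N X.
  by nia.
have gsum : #|good| <= \sum_iota #|Wi iota|.
  apply: leq_trans (leq_card_bigcup _); apply: subset_leq_card; apply/subsetP.
  by move=> f; rewrite inE => /existsP[iota fi]; apply/bigcupP; exists iota.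
(* Pigeonhole over the positions. *)
apply: contrapT => no; have {}no iota : r * d * M * M ^ r.+1 * #|Wi iota| < n ^ M.
  by rewrite ltnNge; apply/negP => h; apply: no; exists iota.
have CI : #|{ffun 'I_r.+1 -> 'I_M}| = M ^ r.+1 by rewrite card_ffun !card_ord.
have lt : \sum_iota (r * d * M * M ^ r.+1 * #|Wi iota| + 1) <= M ^ r.+1 * n ^ M.
  rewrite -{2}CI -sum_nat_const; apply: leq_sum => i _; rewrite addn1; exact: no.
move: lt; rewrite big_split /= sum1_card CI -big_distrr /= leqNgt => /negP; apply.
have M0 : 0 < M ^ r.+1 by rewrite expn_gt0 /M addn2.
have h1 := leq_mul (leqnn (M ^ r.+1)) goodle.
have h2 := leq_mul (leqnn (r * d * M * M ^ r.+1)) gsum.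
rewrite -[X in X < _]addn0 -addSn; move: h1 h2 M0.
move: (n ^ M) (M ^ r.+1) #|good| (\sum_iota _) (r * d * M) => a b c1 x y.
by nia.
Qed.

(** * The upper bound *)

(** If membership in [B j] determines the value of [f] at the position [z j] from
    its other values, then [B j] contains at most a proportion [1 / #|V|] of all
    functions. *)
Lemma union_bound (P V J : finType) (z : J -> P) (B : J -> {set {ffun P -> V}}) :
  (forall j (f g : {ffun P -> V}), f \in B j -> g \in B j ->
     (forall x, x != z j -> f x = g x) -> f = g) ->
  #|V| * #|\bigcup_j B j| <= #|J| * #|V| ^ #|P|.
Proof.
move=> det.
have Bj j : #|V| * #|B j| <= #|V| ^ #|P|.
  pose upd (w : V * {ffun P -> V}) :=
    [ffun x => if x == z j then w.1 else w.2 x] : {ffun P -> V}.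
  have <- : #|{ffun P -> V}| = #|V| ^ #|P| by rewrite card_ffun.
  rewrite -[#|V|]cardsT -cardsX.
  rewrite -(@card_in_imset _ _ upd) ?max_card // => -[v f] [w g].
  rewrite !inE /= => fB gB /ffunP eq_upd.
  have := eq_upd (z j); rewrite !ffunE eqxx /= => ->; congr pair.
  apply: (det j) => // x xz.
  by have := eq_upd x; rewrite !ffunE (negbTE xz).
apply: leq_trans (leq_mul (leqnn #|V|) (leq_card_bigcup B)) _.
by rewrite big_distrr -sum_nat_const /=; apply: leq_sum => j _.
Qed.

(** Let [e] be a graph whose edges have pairwise distinct colors, while the
    colors of the other pairs are arbitrary. If [e] is dense enough, it contains
    a complete [(r.+1)]-partite graph [F] with parts of size [s] such that no
    pair inside a part has the color of a pair between two parts. Indeed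
    complete multipartite configurations have positive density by
    [supersaturation] and [blowup_density], whereas the undesired ones are
    negligible by [union_bound]: equality of two vertices determines one from
    the other, and if the pair at positions [x], [y] has the color of the edge
    at positions [u], [v], with [v] distinct from [x], [y] and [u], then this
    color determines the edge, hence the vertex at [v]. *)
Lemma clean_blowup (r d s : nat) : 0 < r -> 0 < d ->
  exists n0, forall (V : finType) (C : eqType) (c : {set V} -> C) (e : rel V),
    n0 <= #|V| -> symmetric e -> irreflexive e ->
    (forall x y u v, e x y -> e u v ->
       c [set x; y] = c [set u; v] -> [set x; y] = [set u; v]) ->
    (d * (r - 1) + 1) * #|V| ^ 2 <= r * d * \sum_x #|[set y | e x y]| ->
    exists F : 'I_r.+1 -> 'I_s -> V,
      [/\ forall i j a b, i != j -> e (F i a) (F j b),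
          forall i, injective (F i) &
          forall i a b j l a' b', j != l ->
            c [set F i a; F i b] != c [set F j a'; F l b']].
Proof.
move=> r0 d0; pose M := d * (r - 1) + 2.
have [D HD] := blowup_density M s (r * d * M * M ^ r.+1).
pose P : finType := ('I_M * 'I_s)%type.
pose J : finType := (P * P * (P * P) + P * P)%type.
(* With more vertices than this, the configurations outnumber the bad functions. *)
exists (D * #|J|).+1 => V C c e nV eC e0 rb dense.
have V0 : 0 < #|V| by apply: leq_trans nV.
have [iota Hiota] := supersaturation r0 d0 V0 eC e0 dense.
rewrite -/M in iota Hiota.
have /card_gt0P[x0 _] := V0.
pose W (l : seq V) := [forall i, forall j, (i != j) ==>
  e (nth x0 l (iota i : 'I_M)) (nth x0 l (iota j : 'I_M))].
have {}Hiota : #|V| ^ M <= r * d * M * M ^ r.+1 * #|[set t : M.-tuple V | W t]|.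
  apply: leq_trans Hiota _; rewrite leq_mul2l; apply/orP; right.
  pose tup (f : {ffun 'I_M -> V}) := [tuple f i | i < M].
  have tupI : injective tup.
    move=> f g /(congr1 (@tnth _ _)) fg; apply/ffunP => i.
    by have := congr1 (@^~ i) fg; rewrite !tnth_mktuple.
  rewrite -(card_imset _ tupI); apply: subset_leq_card; apply/subsetP.
  move=> _ /imsetP[f + ->]; rewrite !inE => /forallP fP.
  apply/forallP => i; apply/forallP => j; have /forallP/(_ j) := fP i.
  by rewrite -!tnth_nth !tnth_mktuple.
have := HD V W V0 Hiota.
set X0 := [set l | _] => HX.
pose tof (l : M.-tuple (s.-tuple V)) : {ffun P -> V} :=
  [ffun x => tnth (tnth l x.1) x.2].
have tofI : injective tof.
  move=> l1 l2 /ffunP E; apply: eq_from_tnth => i; apply: eq_from_tnth => a.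
  by have := E (i, a); rewrite !ffunE.
pose z (j : J) : P := match j with inl w => w.2.2 | inr w => w.2 end.
pose B (j : J) : {set {ffun P -> V}} :=
  match j with
  | inl ((x, y), (u, v)) => [set f : {ffun P -> V} |
      [&& v != x, v != y, v != u, e (f u) (f v) &
          c [set f x; f y] == c [set f u; f v]]]
  | inr (x, y) => [set f : {ffun P -> V} | (x != y) && (f x == f y)]
  end.
have det j (f g : {ffun P -> V}) : f \in B j -> g \in B j ->
     (forall x, x != z j -> f x = g x) -> f = g.
  move=> fB gB off; apply/ffunP => x.
  have [->|/off//] := eqVneq x (z j).
  case: j fB gB off => [[[x1 y1] [u v]]|[x1 y1]] /=; rewrite !inE; last first.
    move=> /andP[xy /eqP fE] /andP[_ /eqP gE] off.
    by rewrite -fE -gE off.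
  move=> /and5P[vx vy vu ef /eqP cf] /and5P[_ _ _ eg /eqP cg] off.
  move: cg eg; rewrite -(off x1) 1?eq_sym // -(off y1) 1?eq_sym //.
  rewrite -(off u) 1?eq_sym // cf => cg eg.
  have := rb _ _ _ _ ef eg cg; move/setP/(_ (f v)); rewrite !inE eqxx orbT.
  by case: eqP ef => [->|_ _ /esym /eqP //]; rewrite e0.
have UB := union_bound det.
have [l lX lB] : exists2 l, l \in X0 & tof l \notin \bigcup_j B j.
  apply: contrapT => no.
  have XB : tof @: X0 \subset \bigcup_j B j.
    apply/subsetP => _ /imsetP[l lX ->]; apply/negPn/negP => lB.
    by apply: no; exists l.
  have := subset_leq_card XB; rewrite card_imset // => cXB.
  have cP : #|P| = s * M by rewrite card_prod !card_ord mulnC.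
  have nP : 0 < #|V| ^ (s * M) by rewrite expn_gt0 V0.
  rewrite cP in UB; move: UB HX cXB nP nV.
  move: #|J| #|V| (#|V| ^ _) #|X0| #|\bigcup_j _| => j n N x b UB HX cXB nP nV.
  have := leq_mul (leqnn n) (leq_trans HX (leq_mul (leqnn D) cXB)).
  rewrite mulnCA => /leq_trans/(_ (leq_mul (leqnn D) UB)).
  by rewrite mulnA leq_pmul2r // leqNgt nV.
have notB j : tof l \notin B j.
  by apply: contraNN lB => lj; apply/bigcupP; exists j.
pose F i a := tnth (tnth l (iota i)) a.
have FE i a : F i a = tof l (iota i, a) by rewrite ffunE.
have Fe i j a b : i != j -> e (F i a) (F j b).
  move=> ij; pose t := [tuple tnth (tnth l m) (if m == iota i then a else b) | m < M].
  have : W t.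
    rewrite inE in lX; apply: (transversals_in_nth (x0 := x0) lX).
      by rewrite size_map !size_tuple.
    rewrite size_map size_tuple => m mM.
    rewrite -[m]/(val (Ordinal mM)) -tnth_nth tnth_mktuple.
    rewrite (nth_map (nth [tuple of nseq s x0] l 0)) ?size_tuple //.
    by rewrite -tnth_nth mem_tnth.
  move=> /forallP/(_ i)/forallP/(_ j); rewrite ij -!tnth_nth !tnth_mktuple eqxx.
  case: eqP => [->|//]; by rewrite e0.
exists F; split => // [i a b|i a b j k a' b' jk].
  rewrite !FE => fab; apply/eqP; apply: contraT => ab.
  have := notB (inr ((iota i, a), (iota i, b))).
  by rewrite inE -fab eqxx andbT xpair_eqE eqxx ab.
have iotaI : injective iota.
  move=> i1 i2 E; apply/eqP; apply: contraT => i12.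
  have := Fe i1 i2 a a i12.
  by rewrite /F E e0.
(* One of the two parts [j] and [k] is not [i]. *)
wlog ki : j k a' b' jk / k != i => [H|].
  have [ki|] := eqVneq k i; last exact: H.
  by rewrite [[set F j a'; _]]setUC; apply: H; rewrite -?ki // eq_sym.
have := notB (inl ((iota i, a, (iota i, b)), (iota j, a', (iota k, b')))).
rewrite inE !xpair_eqE !(inj_eq iotaI) (negbTE ki) [k == j]eq_sym (negbTE jk) /=.
by rewrite -!FE Fe.
Qed.

Lemma complete_on_subproof (T : finType) (A : {set T}) :
  [forall e in [set e : {set T} | (#|e| == 2) && (e \subset A)],
     (#|e| == 2) && (e \subset A)].
Proof. by apply/forall_inP => e; rewrite inE. Qed.

Definition complete_on (T : finType) (A : {set T}) : graph T :=
  Graph (complete_on_subproof A).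

(** Choose one edge of each color; if there are too many colors, these edges form
    a graph to which [clean_blowup] applies. Take a copy of [K_p] inside the
    resulting [r.+1] parts of size [q - 1], and suppose that [H] occurs in one of
    its color classes. Since [H] has [q] vertices and is connected, one of its
    edges [{u, v}] joins two parts. As [q] is at least 3, another edge leaves
    [{u, v}]. That edge cannot lie inside a part, by the choice of the parts,
    nor between two parts, because edges between parts have distinct colors. *)
Lemma coloring_upper (T : finType) (H : graph T) (q p r d : nat) :
  connected_graph H -> #|verts H| = q -> 3 <= q ->
  p <= r.+1 * (q - 1) -> 0 < r -> 0 < d ->
  exists n0, forall n m (c : {set 'I_n} -> 'I_m), n0 <= n ->
    good_coloring (complete_graph p) (graphs_containing H) c ->
    r * d * (2 * m) <= (d * (r - 1) + 1) * n ^ 2.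
Proof.
move=> cH qH q3 pk r0 d0.
have [n0 Hn0] := clean_blowup (q - 1) r0 d0.
exists n0 => n m c n0n [csurj cgood].
rewrite leqNgt; apply/negP => big.
have repP a : exists e, (e \in edges (complete_graph n)) && (c e == a).
  have : a \in [set: 'I_m] by rewrite inE.
  by rewrite -csurj => /imsetP[e eE ->]; exists e; rewrite eE eqxx.
pose rep a := xchoose (repP a).
have repE a : rep a \in edges (complete_graph n).
  by have /andP[] := xchooseP (repP a).
have repK : cancel rep c by move=> a; have /andP[_ /eqP] := xchooseP (repP a).
pose E := [set rep a | a : 'I_m].
have EP e1 e2 : e1 \in E -> e2 \in E -> c e1 = c e2 -> e1 = e2.
  by move=> /imsetP[a _ ->] /imsetP[b _ ->]; rewrite !repK => ->.
have E2 : {in E, forall e : {set 'I_n}, #|e| = 2}.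
  move=> _ /imsetP[a _ ->]; apply/eqP.
  by rewrite -edges_complete.
pose e := [rel x y : 'I_n | [set x; y] \in E].
have eC : symmetric e by move=> x y; rewrite /= setUC.
have e0 : irreflexive e.
  by move=> x; apply/negP => /E2; rewrite setUid cards1.
have nV : n0 <= #|'I_n| by rewrite card_ord.
have dense : (d * (r - 1) + 1) * #|'I_n| ^ 2 <=
             r * d * \sum_x #|[set y | e x y]|.
  rewrite (sum_degree E2) card_imset; last exact: can_inj repK.
  by rewrite !card_ord; apply: ltnW.
have [F [Fe FI Fc]] := Hn0 _ _ c e nV eC e0 (fun x y u v => @EP _ _) dense.
pose Phi (w : 'I_r.+1 * 'I_(q - 1)) := F w.1 w.2.
have PhiI : injective Phi.
  move=> [i a] [j b]; rewrite /Phi /=; have [->|ij Eij] := eqVneq i j.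
    by move/FI ->.
  by have := Fe i j a b ij; rewrite Eij e0.
have pw : p <= #|{: 'I_r.+1 * 'I_(q - 1)}| by rewrite card_prod !card_ord.
pose psi (i : 'I_p) := Phi (enum_val (widen_ord pw i)).
have psiI : injective psi.
  by move=> i j /PhiI/enum_val_inj/(congr1 val) /= /val_inj.
pose A := [set psi i | i : 'I_p].
have [] := cgood (complete_on A).
  by apply/is_copy_completeP; rewrite card_imset // card_ord.
move=> a _ /containsP[f [fI fV fE]].
have fA x : x \in verts H -> exists i b, f x = F i b.
  move/fV => /bigcupP[h]; rewrite inE => /andP[]; rewrite inE => /andP[_ hA] _.
  move/(subsetP hA)/imsetP => [i _ ->].
  by rewrite /psi; set w := enum_val _; exists w.1, w.2.
have fadj x y : adj H x y -> c [set f x; f y] = a.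
  by move/fE; rewrite inE imsetU1 imset_set1 => /andP[_ /eqP].
have [/set0Pn[v0 v0H] _] := cH.
have [i0 [a0 fv0]] := fA v0 v0H.
pose A1 := [set v | f v \in codom (F i0)].
(* A part is too small for [H]. *)
have [y yH yA1] : exists2 y, y \in verts H & y \notin A1.
  apply: contrapT => no.
  have : #|f @: verts H| <= #|codom (F i0)|.
    apply: subset_leq_card; apply/subsetP => _ /imsetP[x xH ->].
    apply: contrapT => /negP xA; apply: no; exists x => //.
    by rewrite inE.
  by rewrite card_in_imset // qH card_codom // card_ord; lia.
have v0A : v0 \in A1 by rewrite inE fv0 codom_f.
have [u [v [uA vA uv]]] := connected_leave cH v0H yH v0A yA1.
have [uH vH] := adj_verts uv.
have [j1 [c1 [j2 [c2 [fu fv j12]]]]] : exists j1 c1 j2 c2,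
    [/\ f u = F j1 c1, f v = F j2 c2 & j1 != j2].
  move: uA vA; rewrite !inE => /codomP[c1 fu]; have [j2 [c2 fv]] := fA v vH.
  rewrite fv => vA; exists i0, c1, j2, c2; split => //.
  by apply: contraNneq vA => ->; apply: codom_f.
have euv : e (f u) (f v) by rewrite fu fv; apply: Fe.
have [w wH wuv] : exists2 w, w \in verts H & w \notin [set u; v].
  apply: contrapT => no.
  have : #|verts H| <= #|[set u; v]|.
    apply: subset_leq_card; apply/subsetP => x xH.
    by apply: contrapT => /negP xA; apply: no; exists x.
  by rewrite qH cards2 => /(leq_trans q3); case: (u != v).
have [u' [w' [uA' wA' uw']]] := connected_leave cH uH wH (set21 u v) wuv.
have [uH' wH'] := adj_verts uw'.
have [i1 [b1 fu']] := fA u' uH'; have [i2 [b2 fw']] := fA w' wH'.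
have euw : e (f u') (f w').
  rewrite fu' fw'; have [i12|] := eqVneq i1 i2; last exact: Fe.
  have := Fc i2 b1 b2 j1 j2 c1 c2 j12.
  by rewrite -{1}i12 -fu' -fw' -fu -fv !fadj // eqxx.
have := EP _ _ euv euw; rewrite (fadj _ _ uv) (fadj _ _ uw') => /(_ erefl).
move/setP/(_ (f w')); rewrite !inE eqxx orbT => /orP[] /eqP /fI wE.
- by move: wA'; rewrite wE // !inE eqxx.
- by move: wA'; rewrite wE // !inE eqxx orbT.
Qed.

(** * Turan numbers and the lower bound *)

Lemma leq_ex n (T : finType) (F : graph T) (G : graph 'I_n) :
  #|verts G| = n -> ~ contains G F -> #|edges G| <= ex n F.
Proof.
move=> vG GF.
have eG : #|edges G| < #|edges (complete_graph n)|.+1.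
  rewrite ltnS; apply: subset_leq_card; apply/subsetP => e.
  by rewrite edges_complete => eG; have /forall_inP/(_ e eG)/andP[] := edgesP G.
by apply: (@leq_bigmax_cond _ _ _ (Ordinal eG)); apply/asboolP; exists G.
Qed.

Lemma ex_attained n k : 1 < k ->
  exists G : graph 'I_n,
    [/\ #|verts G| = n, #|edges G| = ex n (complete_graph k) &
        ~ contains G (complete_graph k)].
Proof.
move=> k1; apply: (big_ind (fun m => exists G : graph 'I_n,
    [/\ #|verts G| = n, #|edges G| = m & ~ contains G (complete_graph k)])).
- pose G0 := graph_of_rel (fun _ _ : 'I_n => false).
  have E0 : edges G0 = set0.
    apply/setP => e; rewrite inE; apply/negP => eG; move: (eG).
    have [x [y [_ -> _ _]]] := edge_pair eG.
    by rewrite -/(adj _ x y) adj_graph_of_rel andbF.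
  exists G0; split; rewrite ?E0 ?cards0 ?cardsT ?card_ord //.
  move=> /containsP[f [_ _ /(_ [set Ordinal (ltnW k1); Ordinal k1])]].
  by rewrite edges_complete cards2 E0 in_set0 => /(_ isT).
- by move=> a b Ha Hb; rewrite /maxn; case: ifP.
- by move=> m /asboolP.
Qed.

Definition cross_graph n r (h : 'I_n -> 'I_r) : graph 'I_n :=
  graph_of_rel (fun x y => h x != h y).

Lemma adj_cross_graph n r (h : 'I_n -> 'I_r) x y :
  adj (cross_graph h) x y = (h x != h y).
Proof.
rewrite adj_graph_of_rel [h y == _]eq_sym orbb.
by case: (x =P y) => [->|_]; rewrite ?eqxx.
Qed.

Lemma card_edges_cross_graph n r (h : 'I_n -> 'I_r) :
  2 * #|edges (cross_graph h)| = cross_pairs h.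
Proof.
rewrite -(sum_degree (@card_edge _ _)); apply: eq_bigr => x _.
by apply: eq_card => y; rewrite !inE -/(adj _ x y) adj_cross_graph.
Qed.

Lemma cross_graph_free n r (h : 'I_n -> 'I_r) :
  ~ contains (cross_graph h) (complete_graph r.+1).
Proof.
move=> /containsP[f [_ _ fE]].
have hfI : injective (h \o f).
  move=> i j /= hij; apply/eqP; apply: contraT => ij.
  have := fE [set i; j]; rewrite edges_complete cards2 ij => /(_ isT).
  rewrite imsetU1 imset_set1 -/(adj _ (f i) (f j)) adj_cross_graph hij.
  by rewrite eqxx.
by have := leq_card _ hfI; rewrite !card_ord ltnn.
Qed.

(** The extremal number of [K_(r.+1)] is attained by a balanced complete
    [r]-partite graph, by [turan_coloring] applied to an extremal graph. *)
Lemma ex_balanced n r : 0 < r ->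
  exists h : 'I_n -> 'I_r,
    2 * ex n (complete_graph r.+1) = cross_pairs h /\
    forall a b, class_size h a <= (class_size h b).+1.
Proof.
move=> r0; have [G [vG eG GK]] := ex_attained n (r0 : 1 < r.+1).
have VT : verts G = setT.
  by apply/eqP; rewrite eqEcard subsetT cardsT card_ord vG /=.
have cl : cliques_le (adj G) [set: 'I_n] r.
  move=> B _ Be; rewrite leqNgt; apply/negP => cB; apply: GK; apply/containsP.
  exists (fun i => enum_val (widen_ord cB i)).
  have fI : injective (fun i => enum_val (widen_ord cB i)).
    by move=> i j /enum_val_inj/(congr1 val) /= /val_inj.
  split=> [i j _ _|i _|e /edge_pair[i [j [ij -> _ _]]]].
  - exact: fI.
  - by rewrite VT inE.
  - by rewrite imsetU1 imset_set1; apply: Be; rewrite ?enum_valP ?(inj_eq fI).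
have G0 : irreflexive (adj G) by move=> x; apply/negP => /adj_neq; rewrite eqxx.
have [h [hle bal]] := turan_coloring r0 (@adjC _ G) G0 cl.
exists h; split=> //; apply/eqP; rewrite eqn_leq -{1}eG.
rewrite -(sum_degree (@card_edge _ G)) hle /=.
rewrite -card_edges_cross_graph leq_pmul2l //; apply: leq_ex.
  by rewrite cardsT card_ord.
exact: cross_graph_free.
Qed.

(** [g] is 0 or the number of colors of some good coloring. *)
Lemma g_ind n (T : finType) (G : graph T) (F : graph_family) (P : nat -> Prop) :
  P 0 -> (forall m (c : {set 'I_n} -> 'I_m), good_coloring G F c -> P m) ->
  P (g n G F).
Proof.
move=> P0 Pm; apply: (big_ind P) => // [a b Pa Pb|m /asboolP[c /Pm] //].
by rewrite /maxn; case: ifP.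
Qed.

Lemma leq_g n (T : finType) (G : graph T) (F : graph_family) m
    (c : {set 'I_n} -> 'I_m) :
  good_coloring G F c -> m <= g n G F.
Proof.
move=> good; have [surj _] := good.
have mE : m < #|edges (complete_graph n)|.+1.
  by rewrite ltnS -[m]card_ord -cardsT -surj leq_imset_card.
by apply: (@leq_bigmax_cond _ _ _ (Ordinal mE)); apply/asboolP; exists c.
Qed.

Lemma g_contains_mono n p (T : finType) (H : graph T) :
  verts H != set0 ->
  g n (complete_graph p) (graphs_containing (complete_graph #|verts H|)) <=
  g n (complete_graph p) (graphs_containing H).
Proof.
move=> H0; apply: (@g_ind _ _ _ _ (fun m => m <= _)) => // m c [surj good].
apply: (leq_g (c := c)); split=> // G' /good[a aG' Ka]; exists a => //.
exact: contains_complete.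
Qed.

(** Colorings by any finite type may be used; the colors that occur are then
    renumbered. *)
Lemma leq_g_of_coloring n (T U : finType) (G : graph T) (F : graph U)
    (C : finType) (c : {set 'I_n} -> C) :
  (forall G' : graph 'I_n, is_copy G (complete_graph n) G' ->
     exists2 a, a \in [set c e | e in edges G'] &
                contains (color_class c G' a) F) ->
  #|[set c e | e in edges (complete_graph n)]| <= g n G (graphs_containing F).
Proof.
set I := [set c e | e in _] => cP.
have [->|[a0 a0I]] := set_0Vmem I; first by rewrite cards0.
pose c' e : 'I_#|I| := enum_rank_in a0I (c e).
apply: (leq_g (c := c')); split.
  apply/setP => i; rewrite inE; apply/imsetP.
  have /imsetP[e eE iE] : enum_val i \in I := enum_valP i.
  by exists e; rewrite // /c' -iE enum_valK_in.
move=> G' G'K; have [a aG' aF] := cP G' G'K.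
have cI e : e \in edges G' -> c e \in I.
  have [[_ sE] _] := G'K; move=> eG'; apply: imset_f.
  exact: (subsetP sE).
have /imsetP[e0 e0G' ae0] := aG'.
exists (c' e0); first exact: imset_f.
apply: contains_subgraph aF.
have EE : edges (color_class c G' a) = edges (color_class c' G' (c' e0)).
  apply/setP => e; rewrite !inE ae0; case: (boolP (e \in edges G')) => //= eG'.
  apply/eqP/eqP => [|/enum_rank_in_inj]; first by rewrite /c' => ->.
  by apply; apply: cI.
have VE : verts (color_class c G' a) = verts (color_class c' G' (c' e0)).
  exact: (congr1 cover EE).
by split; rewrite ?VE ?EE.
Qed.

(** Color the edges between the classes of an extremal [r]-partite graph with
    distinct colors, and the inside of each class with one new color. Among [p]
    vertices, where [p] exceeds [r * (q - 1)], some [q] lie in the same class and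
    span a monochromatic [K_q]. The classes are balanced and [n] is larger than
    [2 * r], so they have at least two vertices each and the [r] new colors do
    occur. *)
Lemma leq_ex_g n p q r :
  0 < r -> 1 < q -> r * (q - 1) < p -> 2 * r < n ->
  ex n (complete_graph r.+1) + r <=
  g n (complete_graph p) (graphs_containing (complete_graph q)).
Proof.
move=> r0 q1 rp rn; have [h [exh bal]] := ex_balanced n r0.
have class2 a : 1 < class_size h a.
  rewrite ltnNge; apply/negP => le1.
  have : \sum_b class_size h b <= \sum_(b < r) 2.
    by apply: leq_sum => b _; apply: leq_trans (bal b a) _.
  by rewrite sum_class_size sum_nat_const !card_ord; lia.
pose c (e : {set 'I_n}) : {set 'I_n} + 'I_r :=
  if [pick a | e \subset [set x | h x == a]] is Some a then inr a else inl e.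
have c_in (e : {set 'I_n}) a x :
    x \in e -> e \subset [set x | h x == a] -> c e = inr a.
  move=> xe ea; rewrite /c; case: pickP => [b eb|/(_ a)]; last by rewrite ea.
  have := subsetP ea x xe; have := subsetP eb x xe.
  by rewrite !inE => /eqP-> /eqP->.
have c_out x y : h x != h y -> c [set x; y] = inl [set x; y].
  move=> hxy; rewrite /c; case: pickP => // a.
  rewrite subUset !sub1set !inE => /andP[/eqP ha /eqP hb].
  by rewrite ha hb eqxx in hxy.
apply: leq_trans (leq_g_of_coloring (c := c) _); last first.
  move=> G' /is_copy_completeP[vG' eG'].
  have [a qa] : exists a, q <= #|[set x in verts G' | h x == a]|.
    apply: contrapT => no.
    have : \sum_a #|[set x in verts G' | h x == a]| <= \sum_(a < r) (q - 1).
      apply: leq_sum => a _; rewrite leqNgt; apply/negP => lt; apply: no.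
      by exists a; move: lt q1; lia.
    have -> : \sum_a #|[set x in verts G' | h x == a]| = p.
      rewrite -vG' -[RHS]sum1_card (partition_big h predT) //=.
      by apply: eq_bigr => a _; rewrite -sum1dep_card.
    by rewrite sum_nat_const card_ord; lia.
  pose f (i : 'I_q) := enum_val (widen_ord qa i).
  have fI : injective f by move=> i j /enum_val_inj/(congr1 val) /= /val_inj.
  have fP i : (f i \in verts G') && (h (f i) == a).
    by have := enum_valP (widen_ord qa i); rewrite inE.
  have cf i j : i != j ->
      ([set f i; f j] \in edges G') /\ c [set f i; f j] = inr a.
    move=> ij; have /andP[fi hi] := fP i; have /andP[fj hj] := fP j; split.
      by rewrite eG' inE cards2 (inj_eq fI) ij /= subUset !sub1set fi.
    by apply: (c_in _ _ (f i)); rewrite ?set21 // subUset !sub1set !inE hi.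
  have other (i : 'I_q) : exists j : 'I_q, i != j.
    have /set0Pn[j] : [set~ i] != set0 by rewrite -card_gt0 cardsC1 card_ord; lia.
    by rewrite !inE eq_sym => ij; exists j.
  exists (inr a).
    have [j /cf[eE ce]] := other (Ordinal (ltnW q1)).
    by apply/imsetP; eexists; [exact: eE|rewrite ce].
  apply/containsP; exists f; split=> [i j _ _|i _|e].
  - exact: fI.
  - have [j /cf[eE ce]] := other i.
    apply/bigcupP; exists [set f i; f j]; last exact: set21.
    by rewrite inE eE ce /=.
  - move=> /edge_pair[i [j [ij -> _ _]]]; rewrite imsetU1 imset_set1.
    by have [eE ce] := cf i j ij; rewrite inE eE ce /=.
have -> : ex n (complete_graph r.+1) = #|edges (cross_graph h)|.
  by apply/eqP; rewrite -(eqn_pmul2l (isT : 0 < 2)) exh card_edges_cross_graph.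
rewrite -[X in _ + X <= _](card_ord r) -cardsT -(card_imset _ (@inl_inj _ 'I_r)).
rewrite -(card_imset [set: 'I_r] (@inr_inj {set 'I_n} _)).
set X := imset _ _; set Y := imset _ _.
have <- : #|X :|: Y| = #|X| + #|Y|.
  apply/eqP; rewrite (leq_card_setU X Y) disjoint_subset; apply/subsetP.
  move=> _ /imsetP[e _ ->].
  by rewrite inE; apply/imsetP => -[].
apply: subset_leq_card; apply/subsetP => w; rewrite inE => /orP[] /imsetP[].
  move=> e eG' ->; apply/imsetP; exists e; first by rewrite edges_complete (card_edge eG').
  have [x [y [_ eE _ _]]] := edge_pair eG'.
  by rewrite eE c_out // -adj_cross_graph /adj -eE.
move=> a _ ->; have /card_gt1P[x [y [xa ya xy]]] := class2 a.
apply/imsetP; exists [set x; y]; first by rewrite edges_complete cards2 xy.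
by rewrite (c_in _ a x) ?set21 // subUset !sub1set xa.
Qed.

Lemma ceil_div_bounds p q : 2 < q -> 2 * q - 1 <= p ->
  exists r, [/\ ceil_div p (q - 1) = r.+1, 1 < r, r * (q - 1) < p &
                p <= r.+1 * (q - 1)].
Proof.
move=> q3 pq; rewrite /ceil_div /dvdn; set s := q - 1.
have s0 : 0 < s by rewrite /s; lia.
have E := divn_eq p s; have L := ltn_pmod p s0.
move: E L; set a := p %/ s; set b := p %% s => E L.
have a2 : 2 <= a by rewrite /a leq_divRL // /s; lia.
case: eqP => [b0|/eqP b0] /=; last by exists a; split; [lia|lia|lia|lia].
by exists a.-1; split; [lia|rewrite /s in E *; nia|nia|nia].
Qed.

(** * Asymptotics *)

From mathcomp Require Import all_classical all_reals topology normedtype sequences.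
Import numFieldNormedType.Exports.
Local Open Scope classical_set_scope.
Local Open Scope ring_scope.

Lemma ex_density n r : (0 < r)%N ->
  ((r - 1) * n ^ 2 <= r * (2 * ex n (complete_graph r.+1)) + r * n)%N.
Proof.
move=> r0; have [h [-> bal]] := ex_balanced n r0.
by have := balanced_cross_pairs bal; rewrite card_ord.
Qed.

(** The main terms of the bounds on [X] and [Y] agree up to [n ^+ 2 / d], while
    [r * n] is of lower order; each is absorbed by half of the margin
    [eps * (r - 1) * n ^+ 2]. *)
Lemma ratio_bound (R : realFieldType) (r d n X Y eps : R) :
  2 <= r -> 0 < n -> 0 < d -> 0 < eps -> 2 <= eps * d ->
  2 * (1 + eps) * r <= eps * n ->
  r * d * (2 * X) <= (d * (r - 1) + 1) * n ^+ 2 ->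
  (r - 1) * n ^+ 2 <= r * (2 * Y) + r * n ->
  X <= (1 + eps) * Y.
Proof.
move=> r2 n0 d0 e0 ed en hX hY.
have rd0 : 0 < r * d * 2 by nra.
rewrite -(ler_pM2l rd0).
have h1 : (1 + eps) * d * ((r - 1) * n ^+ 2 - r * n) <= (1 + eps) * d * (r * (2 * Y)).
  by apply: ler_wpM2l; [nra|lra].
have h2 : 2 * n ^+ 2 <= eps * d * n ^+ 2 by apply: ler_wpM2r => //; nra.
have h3 : d * n * (2 * (1 + eps) * r) <= d * n * (eps * n).
  by apply: ler_wpM2l => //; nra.
have h4 : eps * d * n ^+ 2 <= eps * d * n ^+ 2 * (r - 1).
  by rewrite ler_peMr //; [nra|lra].
lra.
Qed.

(** The error term is forced to be the quotient minus 1; it is nonnegative by the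
    lower bound, and [coloring_upper] applies with any [d], so it tends to 0. *)
Lemma g_asymptotics (R : realType) (q p : nat) (T : finType) (H : graph T) :
  (3 <= q)%N -> (2 * q - 1 <= p)%N -> connected_graph H -> #|verts H| = q ->
  let k := ceil_div p (q - 1) in
  exists2 o1 : nat -> R, o1 n @[n --> \oo] --> (0 : R) &
    forall n : nat, (p <= n)%N ->
      [/\ (ex n (complete_graph k) + k - 1
             <= g n (complete_graph p) (graphs_containing (complete_graph q)))%N,
          (g n (complete_graph p) (graphs_containing (complete_graph q))
             <= g n (complete_graph p) (graphs_containing H))%N &
          (g n (complete_graph p) (graphs_containing H))%:R
             = (1 + o1 n) * (ex n (complete_graph k))%:R].
Proof.
move=> q3 pq cH qH k.
have [r [kE r1 rp pr]] := ceil_div_bounds q3 pq.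
have r0 : (0 < r)%N by apply: ltnW.
have kr : k = r.+1 by [].
rewrite {}kr {k}.
pose X n := g n (complete_graph p) (graphs_containing H).
pose Y n := ex n (complete_graph r.+1).
have lower n : (p <= n)%N ->
    (Y n + r <= g n (complete_graph p) (graphs_containing (complete_graph q)))%N.
  by move=> pn; apply: leq_ex_g => //; nia.
have mid n : (g n (complete_graph p) (graphs_containing (complete_graph q))
             <= X n)%N.
  by rewrite -qH; apply: g_contains_mono; case: cH.
have Y0 n : (p <= n)%N -> (0 < Y n)%N.
  move=> pn; have := @ex_density n r r0; rewrite -/(Y n) => h.
  rewrite lt0n; apply/eqP => E; move: h; rewrite E; nia.
exists (fun n => (X n)%:R / (Y n)%:R - 1); last first.
  move=> n pn; split; [|exact: mid|].
    by have := lower n pn; rewrite /Y; lia.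
  by rewrite addrC subrK divfK // pnatr_eq0 -lt0n Y0.
apply/cvgrPdist_le => eps e0.
pose d := (Num.truncn (2 / eps)).+1.
have ed : 2 <= eps * d%:R.
  by rewrite mulrC -ler_pdivrMr // ltW // truncnS_gt.
have [n0 Hn0] := coloring_upper cH qH q3 pr r0 (ltn0Sn _ : (0 < d)%N).
pose n1 := (Num.truncn (2 * (1 + eps) * r%:R / eps)).+1.
near=> n.
have pn : (p <= n)%N by near: n; apply: nbhs_infty_ge.
have n0n : (n0 <= n)%N by near: n; apply: nbhs_infty_ge.
have n1n : (n1 <= n)%N by near: n; apply: nbhs_infty_ge.
have en : 2 * (1 + eps) * r%:R <= eps * n%:R.
  rewrite mulrC [leRHS]mulrC -ler_pdivrMr // [r%:R * _]mulrC.
  apply: le_trans (ltW (truncnS_gt _)) _; by rewrite ler_nat.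
have hX : (r * d * (2 * X n) <= (d * (r - 1) + 1) * n ^ 2)%N.
  rewrite /X; apply: (@g_ind _ _ _ _ (fun m => (r * d * (2 * m) <= _)%N)) => [|m c].
    by rewrite !muln0.
  exact: Hn0.
have Yp : (0 : R) < (Y n)%:R by rewrite ltr0n Y0.
have XY : (Y n)%:R <= (X n)%:R :> R.
  rewrite ler_nat; apply: leq_trans (mid n); apply: leq_trans (lower n pn).
  exact: leq_addr.
have : (X n)%:R <= (1 + eps) * (Y n)%:R.
  apply: (@ratio_bound _ r%:R d%:R n%:R) => //.
  - by rewrite ler_nat.
  - by rewrite ltr0n; lia.
  - by move: hX; rewrite -mulnn -(ler_nat R) !natrM natrD !natrM natrB // expr2.
  - have := @ex_density n r r0.
    by rewrite -mulnn -(ler_nat R) natrD !natrM natrB // expr2.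
rewrite -ler_pdivrMr // => le.
rewrite sub0r normrN ger0_norm; first by rewrite lerBlDl.
by rewrite subr_ge0 ler_pdivlMr // mul1r.
Unshelve. all: by end_near.
Qed.

Theorem theorem9p26 (R : realType) (q p : nat)
    (hq : (3 <= q)%N) (hp : (2 * q - 1 <= p)%N) :
  let k := ceil_div p (q - 1) in
  [/\ forall (T : finType) (H : graph T),
        connected_graph H -> #|verts H| = q ->
        exists2 o1 : nat -> R, o1 n @[n --> \oo] --> (0 : R) &
        forall n : nat, (p <= n)%N ->
          [/\ (ex n (complete_graph k) + k - 1
                 <= g n (complete_graph p)
                        (graphs_containing (complete_graph q)))%N,
              (g n (complete_graph p) (graphs_containing (complete_graph q))
                 <= g n (complete_graph p) (graphs_containing H))%N &
              (g n (complete_graph p) (graphs_containing H))%:R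
                 <= (1 + o1 n) * (ex n (complete_graph k))%:R],
      exists2 o1 : nat -> R, o1 n @[n --> \oo] --> (0 : R) &
        forall n : nat, (p <= n)%N ->
          (g n (complete_graph p) (graphs_containing (path_graph q)))%:R
            = (1 + o1 n) * (ex n (complete_graph k))%:R &
      exists2 o1 : nat -> R, o1 n @[n --> \oo] --> (0 : R) &
        forall n : nat, (p <= n)%N ->
          (g n (complete_graph p) (graphs_containing (cycle_graph q)))%:R
            = (1 + o1 n) * (ex n (complete_graph k))%:R].
Proof.
move=> k; split.
- move=> T H cH qH; have [o1 o10 o1P] := g_asymptotics R hq hp cH qH.
  by exists o1 => // n /o1P[? ? ->].
- have cP : connected_graph (path_graph q).
    by rewrite -(prednK (leq_trans (ltn0Sn 2) hq)); apply: path_graph_connected.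
  have [|o1 o10 o1P] := g_asymptotics R hq hp cP; first by rewrite cardsT card_ord.
  by exists o1 => // n /o1P[].
- have cP : connected_graph (cycle_graph q).
    by rewrite -(prednK (leq_trans (ltn0Sn 2) hq)); apply: cycle_graph_connected.
  have [|o1 o10 o1P] := g_asymptotics R hq hp cP; first by rewrite cardsT card_ord.
  by exists o1 => // n /o1P[].
Qed.
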